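(* Let $p$ be an odd prime and let $m\in\mathbb Z$ with $p\nmid m$. Set $\bar m=4096/m$. Then $$\left(\frac{-m}p\right)\sum_{k=0}^{p-1}\frac{\binom{2k}k^3}{m^k}-\sum_{k=0}^{p-1}\frac{\binom{2k}k^3}{\bar m^k}\equiv-\frac p2\sum_{k=0}^{p-1}\frac{\binom{2k}k^3}{\bar m^k}\bigl(6(H_{2k}-H_k)-q_p(\bar m)\bigr)\pmod{p^2}.$$
   Context: $H_k=\sum_{0<j\le k}\frac1j$ denotes the $k$-th harmonic number ($H_0=0$). $q_p(t)=(t^{p-1}-1)/p$ is the Fermat quotient, for a rational number $t$ whose numerator and denominator are prime to $p$. $\left(\frac{\cdot}{p}\right)$ is the Legendre symbol. A congruence $s\equiv t\pmod{p^2}$ between rational numbers means $s-t\in p^2\mathbb Z_{(p)}$, where $\mathbb Z_{(p)}$ is the ring of rational numbers with denominator prime to $p$. *)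

(* Defs.v *)
From mathcomp Require Import all_boot all_order all_algebra.

Set Implicit Arguments.
Unset Strict Implicit.
Unset Printing Implicit Defensive.

Import Order.TTheory GRing.Theory Num.Theory.
Local Open Scope ring_scope.

Definition harmonic_number (k : nat) : rat := \sum_(1 <= j < k.+1) j%:R^-1.

Definition fermat_quotient (p : nat) (t : rat) : rat :=
  (t ^+ p.-1 - 1) / p%:R.

(* Intended for odd primes p only: 'F_p is Z/pZ when p is prime. *)
Definition legendre (a : int) (p : nat) : int :=
  if a%:~R == 0 :> 'F_p then 0
  else if [exists x : 'F_p, x ^+ 2 == a%:~R] then 1 else -1.

(* The localization Z_(p), for p prime. *)
Definition Zloc (p : nat) : {pred rat} := [pred x | coprime p `|denq x|%N].

(* s = t modulo p ^ n * Z_(p) *)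
Definition rat_congr (p n : nat) (s t : rat) : Prop :=
  exists2 z : rat, z \in Zloc p & s - t = p%:R ^+ n * z.

(* Main.v *)
(* Put [n = (p - 1) / 2]. The binomial 'C(2k, k) is divisible by [p] for
   [n < k < p], so both sums may be cut at [k = n]. Modulo [p ^ 2],
     'C(2(n-k), n-k) = (-1)^n 16^(n-k) 'C(2k, k) (1 - p (H_(2k) - H_k)):
   the ratios of consecutive terms on both sides agree, and the case [k = 0]
   follows from two expressions of 'C(2n, n): with
   [P = \prod_(i < n) (p / (2i + 2) - 1)] it equals [4 ^ n * P], and as
   'C(p-1, n) it is [(-1) ^ n * P ^ 2]. Reversing the sum over [m ^ k] and
   cubing thus gives the sum over [mbar ^ k] with factors
   [e * (1 - 3 p (H_(2k) - H_k))], where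
   [e = legendre (- m) p * (-1) ^ n * mbar ^ n]. By Euler's criterion [e = 1]
   modulo [p], while [e ^ 2 = mbar ^ (p - 1) = 1 + p q], hence
   [e = 1 + p q / 2] modulo [p ^ 2]. *)
From HB Require Import structures.
Require Import Defs.
From mathcomp Require Import all_boot all_order all_algebra.
From mathcomp Require Import cyclic finfield ring zify.

Set Implicit Arguments.
Unset Strict Implicit.
Unset Printing Implicit Defensive.

Import Order.TTheory GRing.Theory Num.Theory.
Local Open Scope ring_scope.

(** * The localization [Zloc p] as a subring of the rationals *)

(** The fraction need not be reduced: the reduced denominator divides [d], so it inherits
    coprimality with [p]. *)
Lemma Zloc_div (p : nat) (a : int) (d : nat) :
  coprime p d -> a%:~R / d%:R \in Zloc p.
Proof.
rewrite inE -[coprime p d]/(coprime p `|d%:Z|) -[d%:R]/((d%:Z)%:~R).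
case: divqP => [|k x k0]; first by rewrite coprimen1.
by rewrite abszM coprimeMr => /andP[].
Qed.

Lemma Zloc_frac (p : nat) (z : rat) : z \in Zloc p ->
  exists (a : int) (d : nat), [/\ (0 < d)%N, coprime p d & z = a%:~R / d%:R].
Proof.
rewrite inE => z_loc; exists (numq z), `|denq z|%N; split=> //.
  by rewrite absz_gt0 denq_eq0.
by rewrite -[(absz _)%:R]/(`|denq z|%:Z%:~R) absz_denq divq_num_den.
Qed.

Lemma Zloc_subring_closed (p : nat) : subring_closed (Zloc p).
Proof.
split=> [|x y|x y].
- by rewrite inE coprimen1.
- move=> /Zloc_frac[a [c [c0 cp ->]]] /Zloc_frac[b [d [d0 dp ->]]].
  have -> : a%:~R / c%:R - b%:~R / d%:R
          = (a * d%:Z - b * c%:Z)%:~R / (c * d)%:R :> rat.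
    rewrite rmorphB /= !rmorphM /= ?natrM.
    by field; rewrite !pnatr_eq0 -!lt0n c0 d0.
  by rewrite Zloc_div // coprimeMr cp.
move=> /Zloc_frac[a [c [c0 cp ->]]] /Zloc_frac[b [d [d0 dp ->]]].
have -> : a%:~R / c%:R * (b%:~R / d%:R) = (a * b)%:~R / (c * d)%:R :> rat.
  by rewrite !rmorphM /= ?natrM mulrACA -invfM.
by rewrite Zloc_div // coprimeMr cp.
Qed.

HB.instance Definition _ (p : nat) :=
  GRing.isSubringClosed.Build rat (Zloc p) (Zloc_subring_closed p).

Lemma Zloc_invn (p d : nat) : coprime p d -> d%:R^-1 \in Zloc p.
Proof. by move=> /(Zloc_div 1); rewrite mul1r. Qed.

Lemma Zloc_invz (p : nat) (a : int) : prime p -> ~~ (p %| a)%Z ->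
  a%:~R^-1 \in Zloc p.
Proof.
move=> pP pa; have: coprime p `|a| by rewrite prime_coprime.
by case: a {pa} => a /Zloc_invn //; rewrite NegzE rmorphN /= invrN rpredN.
Qed.

(** * Calculus of congruences modulo [p ^ n] *)

Lemma rat_congr_refl (p n : nat) (s : rat) : rat_congr p n s s.
Proof. by exists 0; rewrite ?rpred0 // subrr mulr0. Qed.

Lemma rat_congr_sym (p n : nat) (s t : rat) :
  rat_congr p n s t -> rat_congr p n t s.
Proof.
by move=> [z Hz E]; exists (- z); rewrite ?rpredN // mulrN -E opprB.
Qed.

Lemma rat_congr_trans (p n : nat) (s t u : rat) :
  rat_congr p n s t -> rat_congr p n t u -> rat_congr p n s u.
Proof.
move=> [y Hy E] [z Hz F]; exists (y + z); rewrite ?rpredD //.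
by rewrite mulrDr -E -F; ring.
Qed.

Lemma rat_congrD (p n : nat) (s t u v : rat) :
  rat_congr p n s t -> rat_congr p n u v -> rat_congr p n (s + u) (t + v).
Proof.
move=> [y Hy E] [z Hz F]; exists (y + z); rewrite ?rpredD //.
by rewrite mulrDr -E -F; ring.
Qed.

Lemma rat_congrN (p n : nat) (s t : rat) :
  rat_congr p n s t -> rat_congr p n (- s) (- t).
Proof.
by move=> [y Hy E]; exists (- y); rewrite ?rpredN // mulrN -E; ring.
Qed.

(** From [s * u - t * v = (s - t) * u + t * (u - v)]. *)
Lemma rat_congrM (p n : nat) (s t u v : rat) : u \in Zloc p -> t \in Zloc p ->
  rat_congr p n s t -> rat_congr p n u v -> rat_congr p n (s * u) (t * v).
Proof.
move=> Hu Ht [y Hy E] [z Hz F]; exists (y * u + t * z).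
  by rewrite rpredD // rpredM.
by rewrite mulrDr mulrA -E mulrCA -F; ring.
Qed.

Lemma rat_congrMl (p n : nat) (c s t : rat) : c \in Zloc p ->
  rat_congr p n s t -> rat_congr p n (c * s) (c * t).
Proof.
move=> Hc [y Hy E]; exists (c * y); rewrite ?rpredM //.
by rewrite mulrCA -E; ring.
Qed.

Lemma rat_congrX (p n e : nat) (s t : rat) : s \in Zloc p -> t \in Zloc p ->
  rat_congr p n s t -> rat_congr p n (s ^+ e) (t ^+ e).
Proof.
move=> Hs Ht st; elim: e => [|e IHe]; first exact: rat_congr_refl.
by rewrite !exprS; apply: rat_congrM; rewrite ?rpredX.
Qed.

Lemma rat_congr_sum (p n : nat) (I : Type) (r : seq I) (P : pred I)
    (F G : I -> rat) :
  (forall i, P i -> rat_congr p n (F i) (G i)) ->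
  rat_congr p n (\sum_(i <- r | P i) F i) (\sum_(i <- r | P i) G i).
Proof.
move=> FG; elim/big_ind2: _ => //; first exact: rat_congr_refl.
by move=> *; apply: rat_congrD.
Qed.

Lemma rat_congr_sum_nat (p n a b : nat) (F G : nat -> rat) :
  (forall i, (a <= i < b)%N -> rat_congr p n (F i) (G i)) ->
  rat_congr p n (\sum_(a <= i < b) F i) (\sum_(a <= i < b) G i).
Proof.
move=> FG; rewrite big_nat [X in rat_congr _ _ _ X]big_nat.
exact: rat_congr_sum.
Qed.

Lemma rat_congr_prod (p n : nat) (I : Type) (r : seq I) (F G : I -> rat) :
    (forall i, F i \in Zloc p) -> (forall i, G i \in Zloc p) ->
    (forall i, rat_congr p n (F i) (G i)) ->
  rat_congr p n (\prod_(i <- r) F i) (\prod_(i <- r) G i).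
Proof.
move=> HF HG FG; elim: r => [|i r IHr].
  by rewrite !big_nil; apply: rat_congr_refl.
by rewrite !big_cons; apply: rat_congrM => //; apply: rpred_prod.
Qed.

(** * Legendre symbol and Euler's criterion *)

Lemma legendre_sqr (a : int) (p : nat) : prime p -> ~~ (p %| a)%Z ->
  legendre a p ^+ 2 = 1.
Proof.
move=> pP; rewrite (dvdz_pcharf (pchar_Fp pP)) /legendre => /negPf->.
by case: ifP.
Qed.

Lemma Fp_expf_pred (p : nat) (x : 'F_p) : prime p -> x != 0 -> x ^+ p.-1 = 1.
Proof.
move=> pP x0; apply: (mulfI x0); rewrite mulr1 -exprS prednK ?prime_gt0 //.
by have := expf_card x; rewrite card_Fp.
Qed.

(** For a nonresidue [a], the power [a ^ n] squares to 1, so it is 1 or -1. Were it 1, then writing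
    [a = g ^ i] with a primitive root [g] gives [2 * n] dividing [i * n], so [i] is even and [a] is
    a square. *)
Lemma euler_criterion (p n : nat) (a : int) : prime p -> p = n.*2.+1 ->
  ~~ (p %| a)%Z -> (legendre a p)%:~R = a%:~R ^+ n :> 'F_p.
Proof.
move=> pP pn; rewrite (dvdz_pcharf (pchar_Fp pP)) /legendre => a0.
rewrite (negPf a0); case: existsP => [[x /eqP Ex]|nx].
  have x0 : x != 0 by apply: contraNneq a0 => x0; rewrite -Ex x0 expr0n.
  by rewrite -Ex -exprM mul2n -[n.*2]/(n.*2.+1.-1) -pn Fp_expf_pred.
have E : (a%:~R ^+ n) ^+ 2 = 1 :> 'F_p.
  by rewrite -exprM muln2 -[n.*2]/(n.*2.+1.-1) -pn Fp_expf_pred.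
move/eqP: E; rewrite sqrf_eq1 => /orP[/eqP E|/eqP-> //]; case: nx.
have n0 : (0 < n)%N by case: (n) pn pP => // ->.
have /hasP[g _ gP] : has (p.-1).-primitive_root (enum (predC1 (0 : 'F_p))).
  apply: has_prim_root; rewrite ?enum_uniq ?pn ?double_gt0 // -?pn.
    apply/allP => x; rewrite mem_enum inE => x0.
    by rewrite unity_rootE Fp_expf_pred.
  by rewrite -cardE cardC1 card_Fp.
have [i Ei] := prim_rootP gP (Fp_expf_pred pP a0).
have Ep : p.-1 = (2 * n)%N by rewrite mul2n pn.
move/eqP: E; rewrite Ei -exprM -(prim_order_dvd gP) {1}Ep.
rewrite dvdn_pmul2r // => /dvdnP[j ->].
by exists (g ^+ j); rewrite -exprM.
Qed.

(** * Central binomials: recurrence and divisibility by [p] *)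

Lemma central_binS (k : nat) :
  (k.+1 * 'C(2 * k.+1, k.+1) = 2 * (k.*2.+1 * 'C(2 * k, k)))%N.
Proof.
have E1 := mul_bin_diag (k.*2.+2) k; have E2 := mul_bin_diag (k.*2.+1) k.
have E3 : 'C(k.*2.+1, k) = 'C(k.*2.+1, k.+1).
  by rewrite -bin_sub; [congr 'C(_, _)|]; lia.
rewrite /= in E1 E2; rewrite !mul2n doubleS; lia.
Qed.

Lemma prime_dvd_fact (p n : nat) : prime p -> (p %| n`!)%N = (p <= n)%N.
Proof.
move=> pP; apply/idP/idP => [|pn]; last by rewrite dvdn_fact ?prime_gt0.
elim: n => [|n IHn]; first by rewrite dvdn1 => /eqP p1; rewrite p1 in pP.
rewrite factS Euclid_dvdM // => /orP[/dvdn_leq-> //|/IHn]; exact: leqW.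
Qed.

Lemma central_bin_coprime (p k : nat) : prime p -> (2 * k < p)%N ->
  coprime p 'C(2 * k, k).
Proof.
move=> pP kp; have kk : (k <= 2 * k)%N by lia.
rewrite prime_coprime //; apply/negP => /dvdn_mulr-/(_ (k`! * (2 * k - k)`!)%N).
by rewrite bin_fact // prime_dvd_fact // leqNgt kp.
Qed.

Lemma central_bin_dvd (p k : nat) : prime p -> (k < p <= 2 * k)%N ->
  (p %| 'C(2 * k, k))%N.
Proof.
move=> pP /andP[kp pk]; have kk : (k <= 2 * k)%N by lia.
have : (p %| (2 * k)`!)%N by rewrite prime_dvd_fact.
rewrite -(bin_fact kk) !Euclid_dvdM // !prime_dvd_fact //; lia.
Qed.

Lemma coprime_small (p d : nat) : prime p -> (0 < d < p)%N -> coprime p d.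
Proof.
move=> pP /andP[d0 dp]; rewrite prime_coprime //.
by apply: contraL dp => /dvdn_leq; rewrite -leqNgt; apply.
Qed.

(** * Integrality of harmonic numbers at [p] *)

Lemma harmonic_Zloc (p k : nat) : prime p -> (k < p)%N ->
  harmonic_number k \in Zloc p.
Proof.
move=> pP kp; rewrite /harmonic_number big_nat rpred_sum // => j.
move=> /andP[j0 jk].
by rewrite Zloc_invn // coprime_small // j0 (leq_trans jk).
Qed.

(** Among the denominators [j < 2 * p] only [j = p] is a multiple of [p], and the factor [p] cancels
    it. *)
Lemma p_harmonic_Zloc (p k : nat) : prime p -> (k < 2 * p)%N ->
  p%:R * harmonic_number k \in Zloc p.
Proof.
move=> pP kp; rewrite /harmonic_number mulr_sumr big_nat rpred_sum // => j.
move=> /andP[j0 jk]; have [->|jp] := eqVneq j p.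
  by rewrite divff ?rpred1 // pnatr_eq0 -lt0n prime_gt0.
rewrite rpredM ?rpred_nat // Zloc_invn // prime_coprime //.
apply/negP => /dvdnP[i Ei]; have p0 := prime_gt0 pP.
have : (0 < i < 2)%N.
  rewrite -(ltn_pmul2r p0) -[(i < 2)%N](ltn_pmul2r p0).
  by rewrite mul0n -Ei j0 (leq_ltn_trans _ kp).
by case: i Ei => [|[|]] // Ei; rewrite Ei mul1n eqxx in jp.
Qed.

Lemma harmonic_diff_Zloc (p n k : nat) : prime p -> p = n.*2.+1 ->
  (k <= n)%N -> harmonic_number (2 * k) - harmonic_number k \in Zloc p.
Proof. by move=> pP pn kn; apply: rpredB; apply: harmonic_Zloc => //; lia. Qed.

Lemma p_harmonic_diff_Zloc (p k : nat) : prime p -> (k < p)%N ->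
  p%:R * (harmonic_number (2 * k) - harmonic_number k) \in Zloc p.
Proof.
by move=> pP kp; rewrite mulrBr; apply: rpredB; apply: p_harmonic_Zloc; lia.
Qed.

(** * Central binomials modulo [p ^ 2] *)

Lemma invn_double (k : nat) : k.+1%:R^-1 = 2 * k.*2.+2%:R^-1 :> rat.
Proof. by rewrite -doubleS -mul2n natrM invfM mulVKf. Qed.

Lemma harmonic_diffS (k : nat) :
  harmonic_number (2 * k.+1) - harmonic_number k.+1
  = harmonic_number (2 * k) - harmonic_number k
    + k.*2.+1%:R^-1 - k.*2.+2%:R^-1.
Proof.
rewrite /harmonic_number !mul2n doubleS !(@big_nat_recr _ _ _ _.+1) //=.
by rewrite (invn_double k); ring.
Qed.

Lemma central_binS_rat (k : nat) :
  'C(2 * k.+1, k.+1)%:R = 4 * k.*2.+1%:R / k.*2.+2%:R * 'C(2 * k, k)%:R :> rat.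
Proof.
have /(congr1 (fun i => i%:R : rat)) := central_binS k.
rewrite !natrM => E; apply: (mulfI (_ : k.+1%:R != 0 :> rat)).
  by rewrite pnatr_eq0.
rewrite {}E; set y := k.*2.+2%:R^-1; set c := k.*2.+1%:R.
have y1 : k.+1%:R * (2 * y) = 1 :> rat by rewrite -invn_double divff ?pnatr_eq0.
transitivity (k.+1%:R * (2 * y) * (2 * (c * 'C(2 * k, k)%:R))).
  by rewrite y1 mul1r.
by ring.
Qed.

(** The recurrence gives [4 ^ k] times the product of [(2i + 1) / (2i + 2)]. Reversing the
    numerators alone replaces [2i + 1] by [(2k + 1) - (2i + 2)]; for [k = n] this brings in
    [p = 2n + 1]. *)
Lemma central_bin_prod (k : nat) :
  'C(2 * k, k)%:R
  = 4 ^+ k * \prod_(0 <= i < k) (k.*2.+1%:R / i.*2.+2%:R - 1) :> rat.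
Proof.
have -> : 'C(2 * k, k)%:R
    = 4 ^+ k * ((\prod_(0 <= i < k) i.*2.+1%:R)
                / \prod_(0 <= i < k) i.*2.+2%:R) :> rat.
  elim: k => [|k IHk]; first by rewrite !big_geq // bin0 divff.
  rewrite central_binS_rat IHk !(@big_nat_recr _ _ _ k) //= invfM exprS; ring.
rewrite [X in X / _]big_nat_rev -prodfV -big_split /=; congr (_ * _).
apply: eq_big_nat => i /andP[_ ik].
have i0 : i.*2.+2%:R != 0 :> rat by rewrite pnatr_eq0.
apply: (mulIf i0); rewrite mulfVK // mulrBl mulfVK // mul1r -natrB; last by lia.
by congr _%:R; lia.
Qed.

Lemma bin_prod (N k : nat) : (k <= N)%N ->
  'C(N, k)%:R = \prod_(0 <= i < k) (N.+1%:R / i.+1%:R - 1) :> rat.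
Proof.
elim: k => [|k IHk] kN; first by rewrite big_nil bin0.
rewrite big_nat_recr //= -IHk ?(ltnW kN) //.
have /(congr1 (fun i => i%:R : rat)) := mul_bin_left N k.
rewrite !natrM natrB ?(ltnW kN) // => E.
have k0 : k.+1%:R != 0 :> rat by rewrite pnatr_eq0.
apply: (mulfI k0); rewrite E mulrCA mulrBr mulrCA divff // -[N.+1]addn1.
by rewrite -[k.+1]addn1 !natrD; ring.
Qed.

Lemma central_bin_half (p n : nat) : prime p -> p = n.*2.+1 ->
  rat_congr p 2 'C(2 * n, n)%:R ((- 1) ^+ n * 16 ^+ n).
Proof.
move=> pP pn; set a := _%:R.
pose P : rat := \prod_(0 <= i < n) (p%:R / i.*2.+2%:R - 1).
have aP : a = 4 ^+ n * P by rewrite /a central_bin_prod -pn.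
have inv_loc (i : 'I_n) : i.*2.+2%:R^-1 \in Zloc p.
  by rewrite Zloc_invn // coprime_small //; have := ltn_ord i; lia.
have aP2 : rat_congr p 2 a ((- 1) ^+ n * P ^+ 2).
  have -> : a = \prod_(i < n) (p%:R / i.+1%:R - 1).
    by rewrite /a bin_prod ?mul2n -?pn ?big_mkord //; lia.
  have -> : (- 1) ^+ n * P ^+ 2 = \prod_(i < n) - (p%:R / i.*2.+2%:R - 1) ^+ 2.
    by rewrite /P big_mkord -prodrXl -[n in _ ^+ n]card_ord -prodrN.
  apply: rat_congr_prod => i.
  - by rewrite (invn_double i) rpredB ?rpredM ?rpred_nat ?rpred1.
  - by rewrite rpredN rpredX // rpredB ?rpredM ?rpred_nat ?rpred1.
  (* With [x = p / (2i + 2)] the factors are [2x - 1] and [- (x - 1) ^ 2], which differ by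
     [x ^ 2]. *)
  - exists (i.*2.+2%:R^-2); first by rewrite -exprVn rpredX.
    by rewrite (invn_double i) -exprVn; ring.
have a_unit : a^-1 \in Zloc p by rewrite Zloc_invn // central_bin_coprime; lia.
have a0 : a != 0 by rewrite pnatr_eq0 -lt0n bin_gt0; lia.
have s2 : (- 1) ^+ n * (- 1) ^+ n = 1 :> rat by rewrite -expr2 sqrr_sign.
(* Multiplying [aP2] by this element leaves [(- 1) ^ n * 16 ^ n] on the left and, since
   [16 ^ n * P ^ 2 = a ^ 2], just [a] on the right. *)
have c_loc : a^-1 * ((- 1) ^+ n * 16 ^+ n) \in Zloc p.
  by rewrite !rpredM ?rpredX ?rpredN ?rpred1 ?rpred_nat.
have := rat_congrMl c_loc aP2.
rewrite mulrAC mulVf // mul1r => /rat_congr_sym; congr rat_congr.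
apply: (mulfI a0); rewrite -!mulrA mulVKf //.
rewrite aP (_ : 16 = 4 * 4 :> rat) // exprMn.
transitivity ((- 1) ^+ n * (- 1) ^+ n * (4 ^+ n * P * (4 ^+ n * P)) : rat).
  by ring.
by rewrite s2 mul1r.
Qed.

Lemma central_bin_reflect (p n k : nat) : prime p -> p = n.*2.+1 ->
  (k <= n)%N ->
  rat_congr p 2 'C(2 * (n - k), n - k)%:R
    ((- 1) ^+ n * 16 ^+ (n - k) * 'C(2 * k, k)%:R
     * (1 - p%:R * (harmonic_number (2 * k) - harmonic_number k))).
Proof.
move=> pP pn; elim: k => [|k IHk] kn.
  by rewrite subn0 muln0 subrr mulr0 subr0 bin0 !mulr1; apply: central_bin_half.
have := IHk (ltnW kn); set j := (n - k.+1)%N.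
have -> : (n - k)%N = j.+1 by rewrite /j; lia.
rewrite !central_binS_rat harmonic_diffS exprS; set D := _ - harmonic_number k.
set b := 'C(2 * j, j)%:R; set a := 'C(2 * k, k)%:R => IH.
set w : rat := j.*2.+1%:R in IH; set x : rat := k.*2.+1%:R.
set y : rat := k.*2.+2%:R.
(* Since [p = w + y] and [2 * j + 2 = p - x], the step from [k] to [k + 1]
   multiplies the correction by [(1 - p / x) / (1 - p / y)], which is
   [1 - p / x + p / y] modulo [p ^ 2]. *)
have pw : p%:R = w + y by rewrite /w /y -natrD; congr _%:R; lia.
have jx : j.*2.+2%:R = w + y - x :> rat.
  by rewrite -pw /x -natrB; [congr _%:R|]; lia.
have D_loc : D \in Zloc p by apply: harmonic_diff_Zloc pn (ltnW kn).
have w_loc : w^-1 \in Zloc p by rewrite Zloc_invn // coprime_small //; lia.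
have x_loc : x^-1 \in Zloc p by rewrite Zloc_invn // coprime_small //; lia.
have y_loc : y^-1 \in Zloc p by rewrite Zloc_invn // coprime_small //; lia.
have i4_loc : 4^-1 \in Zloc p.
  rewrite (_ : 4 = 2 * 2 :> rat) // invfM rpredM // Zloc_invn //;
  by rewrite coprimen2 pn /= odd_double.
have w0 : w != 0 by rewrite pnatr_eq0.
have x0 : x != 0 by rewrite pnatr_eq0.
have y0 : y != 0 by rewrite pnatr_eq0.
have jx0 : w + y - x != 0 by rewrite -jx pnatr_eq0.
(* The inverse of the ratio between the central binomials at [j + 1] and [j]. *)
have c_loc : j.*2.+2%:R / (4 * w) \in Zloc p.
  by rewrite invfM rpredM ?rpred_nat // rpredM.
have a_loc : a \in Zloc p by rewrite rpred_nat.
have xn_loc : x \in Zloc p by rewrite rpred_nat.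
clearbody a b w x y D j.
have := rat_congrMl c_loc IH; rewrite jx.
have -> : (w + y - x) / (4 * w) * (4 * w / (w + y - x) * b) = b.
  by field; rewrite w0 jx0.
move=> H; apply: (rat_congr_trans H).
(* Put [E = D + 1/x - 1/y]. Up to the factor [4 * x / w] and the common powers, the difference is
   [(p/x - 1) * (1 - p * D) - (p/y - 1) * (1 - p * E)]; its terms of order 0 and 1 in [p] cancel. *)
exists ((- 1) ^+ n * 16 ^+ j * a * (4 * x / w)
        * ((D + x^-1 - y^-1) / y - D / x)); last first.
  by rewrite pw; field; rewrite w0 x0 y0.
by rewrite !(rpredM, rpredB, rpredD) ?rpredX ?rpredN ?rpred1 ?rpred_nat.
Qed.

(** * Truncation of the sums *)

(** Beyond [n] the cube carries [p ^ 3], so a weight with a single [p] in its denominator is still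
    harmless. This is needed for the weights with [H_(2k)]. *)
Lemma sum_central_bin_cube_trunc (p n : nat) (v : nat -> rat) :
    prime p -> p = n.*2.+1 ->
    (forall k, (k < p)%N -> p%:R * v k \in Zloc p) ->
  rat_congr p 2 (\sum_(0 <= k < p) 'C(2 * k, k)%:R ^+ 3 * v k)
                (\sum_(0 <= k < n.+1) 'C(2 * k, k)%:R ^+ 3 * v k).
Proof.
move=> pP pn v_loc; have np : (n.+1 <= p)%N.
  by have := prime_gt1 pP; rewrite pn; lia.
rewrite (@big_cat_nat _ _ _ n.+1) //=.
rewrite -[X in rat_congr _ _ _ X]addr0.
apply: rat_congrD; first exact: rat_congr_refl.
suff : rat_congr p 2 (\sum_(n.+1 <= k < p) 'C(2 * k, k)%:R ^+ 3 * v k)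
                     (\sum_(n.+1 <= k < p) 0) by rewrite big1_eq.
apply: rat_congr_sum_nat => k /andP[nk kp].
have /dvdnP[c ->] : (p %| 'C(2 * k, k))%N by rewrite central_bin_dvd //; lia.
exists (c%:R ^+ 3 * (p%:R * v k)).
  by rewrite rpredM ?rpredX ?rpred_nat ?v_loc.
by rewrite natrM; ring.
Qed.

(** * The factor [e] *)

Lemma rat_4096 : 4096 = (2 ^+ 6) ^+ 2 :> rat.
Proof. by rewrite -!natrX. Qed.

(** For [x = 2] this reads [4096 ^ j = (16 ^ j) ^ 3]: powers of [mbar] absorb the cubed powers of 16
    from the reflection. *)
Lemma expr_6_2 (R : pzSemiRingType) (x : R) (j : nat) :
  ((x ^+ 6) ^+ 2) ^+ j = ((x ^+ 4) ^+ j) ^+ 3.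
Proof. by rewrite -!exprM; congr (_ ^+ _); lia. Qed.

(** Used with [x = 2 ^ 6] and [y = m], so that Fermat's little theorem applies to the numerator
    [x ^ (p - 1)]. *)
Lemma exprMn_sqr_div (F : fieldType) (x y : F) (n : nat) : y != 0 ->
  (- 1) ^+ n * (x ^+ 2 / y) ^+ n = x ^+ (2 * n) / (- y) ^+ n.
Proof.
move=> y0; apply: canRL (mulfK _) _; first by rewrite expf_neq0 ?oppr_eq0.
rewrite -!exprMn exprM; congr (_ ^+ n).
by rewrite mulN1r mulrNN divfK.
Qed.

Lemma legendre_expr_half (p n : nat) (m : int) : prime p -> p = n.*2.+1 ->
    ~~ (p %| m)%Z ->
  let u : rat := 4096 / m%:~R in
  let e := (legendre (- m) p)%:~R * (- 1) ^+ n * u ^+ n in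
  (exists2 c, c \in Zloc p & e = 1 + p%:R * c)
  /\ e ^+ 2 = 1 + p%:R * fermat_quotient p u.
Proof.
move=> pP pn pm u e.
have pNm : ~~ (p %| - m)%Z by rewrite dvdzE abszN.
have p0 : p%:R != 0 :> rat by rewrite pnatr_eq0 -lt0n prime_gt0.
have m0 : m%:~R != 0 :> rat.
  by rewrite intr_eq0; apply: contraNneq pm => ->; apply: dvdz0.
have eE : e = (legendre (- m) p)%:~R * (2 ^+ 6) ^+ p.-1 / (- m)%:~R ^+ n.
  rewrite rmorphN /= /e -!mulrA; congr (_ * _).
  have -> : u = (2 ^+ 6) ^+ 2 / m%:~R.
    exact: (congr1 (fun t => t / m%:~R) rat_4096).
  by rewrite exprMn_sqr_div // mul2n pn.
split; last first.
  clearbody u; clear eE.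
  rewrite /e !exprMn sqrr_sign mulr1 -rmorphXn legendre_sqr //= mul1r.
  rewrite -exprM muln2 /fermat_quotient [p in p.-1]pn /=.
  by rewrite mulrC divfK // addrC subrK.
(* Clearing the denominator of [e - 1] leaves an integer that vanishes in ['F_p], by Euler's
   criterion and Fermat's little theorem. *)
have /dvdzP[b Eb] : (p %| legendre (- m) p * (2 ^+ 6) ^+ p.-1 - (- m) ^+ n)%Z.
  rewrite (dvdz_pcharf (pchar_Fp pP)) rmorphB rmorphM /= !rmorphXn /=.
  rewrite (euler_criterion pP pn pNm) Fp_expf_pred ?mulr1 ?subrr //.
  rewrite expf_neq0 // -(dvdz_pcharf (pchar_Fp pP)) dvdzE /=.
  by rewrite -prime_coprime // coprimen2 pn /= odd_double.
exists (b%:~R / (- m)%:~R ^+ n).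
  by rewrite rpredM ?rpred_int // -exprVn rpredX // Zloc_invz.
have mn0 : (- m)%:~R ^+ n != 0 :> rat by rewrite expf_neq0 // rmorphN oppr_eq0.
apply: (mulIf mn0); rewrite eE mulfVK // mulrDl mul1r mulrA mulfVK //.
have /(congr1 (fun i : int => i%:~R : rat)) := Eb.
rewrite rmorphB !rmorphM !rmorphXn /= => E.
by apply/eqP; rewrite addrC -subr_eq E mulrC.
Qed.

Theorem corollary1p1 (p : nat) (m : int) (p_prime : prime p) (p_odd : odd p)
    (p_ndvd_m : ~~ (p %| m)%Z) :
  let mbar : rat := 4096 / m%:~R in
  rat_congr p 2
    ((legendre (- m) p)%:~R * (\sum_(0 <= k < p) 'C(2 * k, k)%:R ^+ 3 / m%:~R ^+ k)
     - \sum_(0 <= k < p) 'C(2 * k, k)%:R ^+ 3 / mbar ^+ k)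
    (- (p%:R / 2) *
     \sum_(0 <= k < p) 'C(2 * k, k)%:R ^+ 3 / mbar ^+ k
       * (6 * (harmonic_number (2 * k) - harmonic_number k)
          - fermat_quotient p mbar)).
Proof.
move=> mbar; set n := p./2.
have pn : p = n.*2.+1 by rewrite -[LHS]odd_double_half p_odd.
pose eps : rat := (legendre (- m) p)%:~R.
have [[c c_loc ec] e2] :
    (exists2 c, c \in Zloc p & eps * (- 1) ^+ n * mbar ^+ n = 1 + p%:R * c)
    /\ (eps * (- 1) ^+ n * mbar ^+ n) ^+ 2 = 1 + p%:R * fermat_quotient p mbar.
  exact: legendre_expr_half p_prime pn p_ndvd_m.
have p0 : p%:R != 0 :> rat by rewrite pnatr_eq0 -lt0n prime_gt0.
have m0 : m%:~R != 0 :> rat.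
  by rewrite intr_eq0; apply: contraNneq p_ndvd_m => ->; apply: dvdz0.
have i2_loc : 2^-1 \in Zloc p by rewrite Zloc_invn // coprimen2.
have m_loc : m%:~R^-1 \in Zloc p by apply: Zloc_invz.
have mbar_loc : mbar \in Zloc p by rewrite rpredM ?rpred_nat.
(* [x] is [2], made opaque because unification otherwise evaluates [4096] in
   unary. *)
have [x [x0 x_loc mbarE E16]] : exists x : rat,
    [/\ x != 0, x^-1 \in Zloc p, mbar = (x ^+ 6) ^+ 2 / m%:~R & 16 = x ^+ 4].
  exists 2; split; [by []|exact: i2_loc| |by rewrite -natrX].
  exact: (congr1 (fun t => t / m%:~R) rat_4096).
clearbody mbar; set q := fermat_quotient p mbar in e2 *.
have mbarX j : mbar ^+ j = (16 ^+ j) ^+ 3 / m%:~R ^+ j.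
  by rewrite mbarE expr_div_n E16 expr_6_2.
have mbarV_loc : mbar^-1 \in Zloc p.
  by rewrite mbarE invf_div rpredM ?rpred_int // -!exprVn !rpredX.
have mbar0 : mbar != 0 by rewrite mbarE mulf_neq0 ?invr_eq0 ?expf_neq0.
have q_loc : p%:R * q \in Zloc p.
  rewrite /q /fermat_quotient mulrC divfK //.
  by rewrite rpredB ?rpredX ?rpred1.
have V_loc k : m%:~R ^- k \in Zloc p by rewrite -exprVn rpredX.
have W_loc k : mbar ^- k \in Zloc p by rewrite -exprVn rpredX.
have i2p_loc : p%:R / 2 \in Zloc p by rewrite rpredM ?rpred_nat.
have T1 := sum_central_bin_cube_trunc p_prime pn
  (fun k _ => rpredM (rpred_nat (Zloc p) p) (V_loc k)).
have T2 := sum_central_bin_cube_trunc p_prime pn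
  (fun k _ => rpredM (rpred_nat (Zloc p) p) (W_loc k)).
pose D k := harmonic_number (2 * k) - harmonic_number k.
have T3 : rat_congr p 2
    (\sum_(0 <= k < p) 'C(2 * k, k)%:R ^+ 3 * (mbar ^- k * (6 * D k - q)))
    (\sum_(0 <= k < n.+1) 'C(2 * k, k)%:R ^+ 3 * (mbar ^- k * (6 * D k - q))).
  apply: sum_central_bin_cube_trunc => // k kp.
  have pD_loc : p%:R * D k \in Zloc p by apply: p_harmonic_diff_Zloc.
  have -> : p%:R * (mbar ^- k * (6 * D k - q))
          = mbar ^- k * (p%:R * D k *+ 6 - p%:R * q) by ring.
  by rewrite rpredM // rpredB // rpredMn.
have eps_loc : eps \in Zloc p by rewrite rpred_int.
have := rat_congrD (rat_congrMl eps_loc T1) (rat_congrN T2).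
move/rat_congr_trans; apply.
under [X in rat_congr _ _ _ (_ * X)]eq_bigr do rewrite -mulrA.
apply: rat_congr_sym.
have Np_loc : - (p%:R / 2) \in Zloc p by rewrite rpredN.
apply: (rat_congr_trans (rat_congrMl Np_loc T3)).
apply: rat_congr_sym.
(* Reversing [k] to [n - k] in the sum over [m ^ k] makes the claim a termwise congruence. *)
rewrite [X in eps * X]big_nat_rev !mulr_sumr -sumrB.
apply: rat_congr_sum_nat => k /andP[_ kn]; rewrite add0n subSS.
have D_loc : D k \in Zloc p by apply: harmonic_diff_Zloc pn kn.
have R := central_bin_reflect p_prime pn (kn : (k <= n)%N).
rewrite -/(D k) in R.
have w_loc : eps / m%:~R ^+ (n - k) \in Zloc p by rewrite rpredM.
have R_loc : (- 1) ^+ n * 16 ^+ (n - k) * 'C(2 * k, k)%:R * (1 - p%:R * D k)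
    \in Zloc p.
  rewrite rpredM ?rpredB ?(rpredM _ D_loc) ?rpred1 ?rpred_nat //.
  by rewrite rpredM ?rpredM ?rpredX ?rpredN1 ?rpred_nat.
have [z z_loc] := rat_congrMl w_loc (rat_congrX 3 (rpred_nat _ _) R_loc R).
set b := 'C(2 * k, k)%:R; set b' := 'C(_, _)%:R.
(* Cubing keeps the sign [(- 1) ^ n], and [16 ^ (3 (n - k)) / m ^ (n - k)] is [mbar ^ (n - k)], so
   the prefactor is [e / mbar ^ k] with [e = 1 + p * c]. *)
have -> : eps / m%:~R ^+ (n - k)
    * ((- 1) ^+ n * 16 ^+ (n - k) * b * (1 - p%:R * D k)) ^+ 3
  = (1 + p%:R * c) * (b ^+ 3 / mbar ^+ k) * (1 - p%:R * D k) ^+ 3.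
  rewrite -ec.
  have -> : mbar ^+ n = mbar ^+ (n - k) * mbar ^+ k by rewrite -exprD subnK.
  have s3 : ((- 1) ^+ n) ^+ 3 = (- 1) ^+ n :> rat.
    by rewrite exprS sqrr_sign mulr1.
  rewrite [mbar ^+ (n - k)]mbarX.
  have mk0 : mbar ^+ k != 0 by rewrite expf_neq0.
  rewrite !exprMn s3.
  move: (mbar ^+ k) mk0 => M M0; move: (m%:~R ^+ _)^-1 => iM.
  move: (16 ^+ _) ((-1) ^+ n) => t s.
  by field.
move=> E.
(* The two expressions of [e ^ 2] are compared; this gives [p * c] as [p * q / 2] modulo [p ^ 2]. *)
have pq : p%:R * q = 2 * (p%:R * c) + (p%:R * c) ^+ 2.
  by apply: (addrI 1); rewrite -e2 ec; ring.
set U := b ^+ 3 / mbar ^+ k in E *.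
have U_loc : U \in Zloc p by rewrite rpredM // rpredX // rpred_nat.
have pM_loc t : t \in Zloc p -> p%:R * t \in Zloc p.
  by move=> t_loc; rewrite rpredM // rpred_nat.
(* Here [z] is the error of the reflection. The rest is what remains of [(1 + p c) (1 - p D) ^ 3 - 1
   + 3 p D - p q / 2] after substituting [pq] and dividing by [p ^ 2]. *)
exists (z + U * ((1 + p%:R * c) * (D k ^+ 2 *+ 3 - p%:R * D k ^+ 3)
                 - c * D k *+ 3 - c ^+ 2 / 2)).
  apply: rpredD z_loc _; apply: rpredM U_loc _.
  apply: rpredB; [apply: rpredB; first apply: rpredM|].
  - by apply: rpredD; [apply: rpred1|apply: pM_loc].
  - by apply: rpredB; [apply: rpredMn|apply: pM_loc]; apply: rpredX.
  - by apply: rpredMn; apply: rpredM.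
  - by apply: rpredM i2_loc; apply: rpredX.
rewrite [_ * (z + _)]mulrDr -E.
have -> : - (p%:R / 2) * (b ^+ 3 * (mbar ^- k * (6 * D k - q)))
   = - U / 2 * (6 * (p%:R * D k) - p%:R * q) by rewrite /U; ring.
rewrite pq; clearbody U b' D.
by field; rewrite expf_neq0.
Qed.
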